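(* Suppose $X_i^TX_i=\beta_iI_d$ with $\beta_i>0$ for every client $i$, and let $\{\hat\theta_i\}_{i=1}^n$ be the $\theta$-components of the minimizer of $$\sum_{j=1}^k\Big(\frac{\lambda_j}{2}\|w_j-\bar w\|^2+\sum_{i\in\mathcal I_j}\Big(\frac{1}{2\sigma_i^2}\|y_i-X_i\theta_i\|^2+\frac{\gamma_i}{2}\|\theta_i-w_j\|^2\Big)\Big)$$ over $\theta_i,w_j,\bar w\in\mathbb R^d$, with $\lambda_j=1/\bar\sigma^2$ for all $j$ and $\gamma_i=1/\bar\sigma_j^2$ for $i\in\mathcal I_j$. Fix a client $i$, let $\hat\theta^d_{i'}=(X_{i'}^TX_{i'})^{-1}X_{i'}^Ty_{i'}$, let $W_i\in\mathbb R^{n_i+(n-1)d}$ be the stacked vector $(y_i,(\hat\theta^d_{i'})_{i'\ne i})$ and $Z_i\in\mathbb R^{(n_i+(n-1)d)\times d}$ the stacked matrix $(X_i;I_d;\dots;I_d)$. Then $\hat\theta_i=L^\star W_i$ for a deterministic matrix $L^\star$ with $L^\star Z_i=I_d$, and for every deterministic matrix $L\in\mathbb R^{d\times(n_i+(n-1)d)}$ with $LZ_i=I_d$ (a linear unbiased estimator of $\theta_i^*$ given $W_i$), $$\mathbb E\|\hat\theta_i-\theta_i^*\|^2\le\mathbb E\|LW_i-\theta_i^*\|^2,$$ the expectation being taken over all randomness in the model.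
   Context: Hierarchical linear model: clients $1,\dots,n$ are partitioned into nonempty disjoint clusters $\mathcal I_1,\dots,\mathcal I_k$. For an unknown $\bar\theta^*\in\mathbb R^d$ and known variances $\bar\sigma^2>0$, $\bar\sigma_j^2>0$, $\sigma_i^2>0$: $\bar\theta_j^*=\bar\theta^*+\bar\xi_j$ with $\bar\xi_j\sim\mathcal N(0,\bar\sigma^2I_d)$ ($j=1,\dots,k$); $\theta_i^*=\bar\theta_j^*+\xi_i$ with $\xi_i\sim\mathcal N(0,\bar\sigma_j^2I_d)$ for $i\in\mathcal I_j$; $y_i=X_i\theta_i^*+\epsilon_i$ with $\epsilon_i\sim\mathcal N(0,\sigma_i^2I_{n_i})$, where $X_i\in\mathbb R^{n_i\times d}$ are deterministic design matrices; all $\bar\xi_j,\xi_i,\epsilon_i$ are mutually independent. *)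

(* Defs.v *)
From HB Require Import structures.
From mathcomp Require Import all_boot all_order all_algebra.
From mathcomp Require Import all_classical all_reals all_analysis.
Set Implicit Arguments. Unset Strict Implicit. Unset Printing Implicit Defensive.
Import Order.TTheory GRing.Theory Num.Theory.
Local Open Scope classical_set_scope.
Local Open Scope ring_scope.

Definition sqnorm {R : realType} {m : nat} (v : 'cV[R]_m) : R :=
  \sum_(k < m) (v k 0) ^+ 2.

Definition mutually_independent {R : realType} (d : measure_display)
  (T : measurableType d) (P : probability T R) (I : finType)
  (X : I -> T -> R) : Prop :=
  (forall i, measurable_fun setT (X i)) /\
  forall (J : {set I}) (B : I -> set R), (forall i, measurable (B i)) ->
    P (\bigcap_(i in [set i | i \in J]) (X i @^-1` B i)) =
    (\prod_(i in J) P (X i @^-1` B i))%E.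

Definition is_centered_normal {R : realType} (d : measure_display)
  (T : measurableType d) (P : probability T R) (X : T -> R) (v : R) : Prop :=
  forall B : set R, measurable B -> P (X @^-1` B) = normal_prob 0 (Num.sqrt v) B.

(* index type of all scalar noise coordinates:
   cluster noises xi_bar_j (j<k, coord<d), client noises xi_i (i<n, coord<d),
   observation noises eps_i (i<n, coord< n_i) *)
Definition noise_index (n k d : nat) (ni : 'I_n -> nat) : finType :=
  (('I_k * 'I_d) + ('I_n * 'I_d) + {i : 'I_n & 'I_(ni i)})%type.

Definition noise_coord {R : realType} {T : Type} (n k d : nat) (ni : 'I_n -> nat)
  (xib : 'I_k -> T -> 'cV[R]_d) (xi : 'I_n -> T -> 'cV[R]_d)
  (eps : forall i : 'I_n, T -> 'cV[R]_(ni i)) (a : noise_index k d ni) : T -> R :=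
  match a with
  | inl (inl (j, r)) => fun t => xib j t r 0
  | inl (inr (i, r)) => fun t => xi i t r 0
  | inr (existT i r) => fun t => eps i t r 0
  end.

Definition noise_var {R : realType} (n k d : nat) (ni : 'I_n -> nat)
  (sbar2 : R) (sc2 : 'I_k -> R) (s2 : 'I_n -> R) (c : 'I_n -> 'I_k)
  (a : noise_index k d ni) : R :=
  match a with
  | inl (inl _) => sbar2
  | inl (inr (i, _)) => sc2 (c i)
  | inr (existT i _) => s2 i
  end.

Definition hobjective {R : realType} (n k d : nat) (ni : 'I_n -> nat)
  (c : 'I_n -> 'I_k) (X : forall i, 'M[R]_(ni i, d)) (s2 : 'I_n -> R)
  (lam : 'I_k -> R) (gam : 'I_n -> R) (y : forall i, 'cV[R]_(ni i))
  (th : 'I_n -> 'cV[R]_d) (w : 'I_k -> 'cV[R]_d) (wbar : 'cV[R]_d) : R :=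
  \sum_(j < k) (lam j / 2 * sqnorm (w j - wbar) +
    \sum_(i < n | c i == j)
      ((2 * s2 i)^-1 * sqnorm (y i - X i *m th i) +
       gam i / 2 * sqnorm (th i - w j))).

Definition stackW {R : realType} (n d : nat) (ni : 'I_n -> nat) (i : 'I_n)
  (yi : 'cV[R]_(ni i)) (thd : 'I_n -> 'cV[R]_d) :
  'cV[R]_(ni i + \sum_(j < n.-1) d) :=
  col_mx yi (\mxcol_(j < n.-1) thd (lift i j)).

Definition stackZ {R : realType} (n d : nat) (ni : 'I_n -> nat) (i : 'I_n)
  (Xi : 'M[R]_(ni i, d)) : 'M[R]_(ni i + \sum_(j < n.-1) d, d) :=
  col_mx Xi (\mxcol_(j < n.-1) (1%:M : 'M[R]_d)).

Arguments stackW {R n d ni} i yi thd.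
Arguments stackZ {R n d ni} i Xi.

(* Main.v *)
Require Import Defs.
From HB Require Import structures.
From mathcomp Require Import all_boot all_order all_algebra.
From mathcomp Require Import all_classical all_reals all_analysis.
From mathcomp Require Import measurable_realfun normal_distribution ring lra.
Import Order.TTheory GRing.Theory Num.Theory.
Local Open Scope classical_set_scope.
Local Open Scope ring_scope.

(** Write a_i = beta_i / s2_i, g_i = 1 / sc2_(c i) and lam = 1 / sbar2.  Consider
scalar weights h (with auxiliary om_j and mu) solving a small linear
system (lemma blup_weights).  Perturbing the minimizer in the single direction
theta_i' += (h_i' / a_i') v, w_j += om_j v, wbar += mu v, the vanishing of the
derivative reads exactly < theta_i - sum_i' h_i' thd_i', v > = 0, so that the
estimator is sum_i' h_i' thd_i'.  The error of any linear unbiased estimator is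
a linear combination of the noise coordinates, so its mean squared error is the
weighted sum of squares of its coefficients (up to the second moment of the
standard normal law, whose value is irrelevant).  The same linear system says
that the cross term between the error of the weighted estimator and its
difference D from another unbiased one is mu * sum_i' tr (D_i' X_i') = 0. *)

(** * Moments of the centered normal law *)

(** Split [exp(-x^2/2)] as [exp(-x^2/4) * exp(-x^2/4)] and use [x^2/4 <= exp(x^2/4)]: one factor
    absorbs [x^2] at the cost of the constant 4, the other is the Gaussian of variance 2. The factor
    [sqrt 2] is the ratio of the two peaks. *)
Lemma sqr_normal_pdf_le {R : realType} (x : R) :
  x ^+ 2 * normal_pdf 0 1 x <= 4 * Num.sqrt 2 * normal_pdf 0 (Num.sqrt 2) x.
Proof.
have s2 : Num.sqrt 2 != 0 :> R by rewrite gt_eqF// sqrtr_gt0.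
have -> : 4 * Num.sqrt 2 * normal_pdf 0 (Num.sqrt 2) x =
    4 * (normal_peak 1 * normal_fun 0 (Num.sqrt 2) x).
  rewrite normal_pdfE// -!mulrA; congr *%R; rewrite mulrA; congr *%R.
  rewrite /normal_peak sqr_sqrtr// expr1n mul1r -mulrnAr sqrtrM//.
  by rewrite invfM mulrA divff// mul1r.
rewrite normal_pdfE ?oner_eq0// mulrCA [leRHS]mulrCA.
rewrite ler_wpM2l ?normal_peak_ge0//.
have -> : normal_fun 0 1 x = expR (- (x ^+ 2 / 4)) * normal_fun 0 (Num.sqrt 2) x.
  rewrite /normal_fun -expRD sqr_sqrtr//; congr expR.
  by field.
rewrite mulrA ler_wpM2r ?normal_fun_ge0// expRN ler_pdivrMr ?expR_gt0//.
rewrite mulrC -ler_pdivrMr// (le_trans _ (expR_ge1Dx _))// lerDr//.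
Qed.

Section normal_moments.
Context {R : realType}.
Implicit Types (s x : R) (f : R -> \bar R).
Local Notation mu := (@lebesgue_measure R).

(** The Radon-Nikodym derivative of the normal law and [normal_pdf] have equal integrals over every
    measurable set, so they agree almost everywhere and the explicit density may replace the
    abstract one. *)
Lemma ge0_integral_normal_prob s f : measurable_fun [set: R] f ->
  (forall x, 0 <= f x)%E ->
  (\int[normal_prob 0 s]_x f x = \int[mu]_x (f x * (normal_pdf 0 s x)%:E))%E.
Proof.
move=> mf f0.
pose N : {finite_measure set (measurableTypeR R) -> \bar R} := normal_prob 0 s.
have dom : N `<< mu := normal_prob_dominates 0 s.
rewrite -(@Radon_Nikodym_SigmaFinite.change_of_variables _ _ _ N mu dom f setT)//.
apply: ae_eq_integral => //.
- apply: emeasurable_funM => //.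
  exact: measurable_int (Radon_Nikodym_SigmaFinite.f_integrable dom).
- apply: emeasurable_funM => //; apply/measurable_EFinP.
  exact: measurable_normal_pdf.
- apply: ae_eqe_mul2l; apply: integral_ae_eq => //.
  + exact: Radon_Nikodym_SigmaFinite.f_integrable.
  + apply/measurable_EFinP; exact: measurable_normal_pdf.
  + by move=> E _ mE; rewrite -(Radon_Nikodym_SigmaFinite.f_integral dom).
Qed.

(* For s = 0 the library sets normal_pdf to the indicator of [0, 1], which is
   not symmetric. *)
Lemma normal_probN s (A : set R) : s != 0 -> measurable A ->
  normal_prob 0 s (-%R @^-1` A) = normal_prob 0 s A.
Proof.
move=> s0 mA.
have mf := measurable_normal_pdf 0 s.
rewrite /normal_prob.
transitivity (\int[mu]_(x in (-%R : _ -> measurableTypeR R) @^-1` A)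
  ((fun y => (normal_pdf 0 s y)%:E) \o -%R) x)%E.
  apply: eq_integral => x _ /=.
  by rewrite normal_pdfE //= /normal_fun !subr0 sqrrN.
rewrite -ge0_integral_pushforward//=; last 2 first.
  by apply/measurable_funTS/measurable_EFinP.
  by move=> x _; rewrite lee_fin normal_pdf_ge0.
by apply: eq_measure_integral => //= B mB _; exact: lebesgue_measureN.
Qed.

(** Finiteness gives integrability of products of noise coordinates and lets the moment be treated
    as a real number below. *)
Lemma normal_second_moment_lty :
  (\int[normal_prob 0 1]_x (x ^+ 2)%:E < +oo :> \bar R)%E.
Proof.
have mX : measurable_fun [set: R] (fun x : R => (x ^+ 2)%:E).
  by apply/measurable_EFinP; exact: measurable_funX.
rewrite ge0_integral_normal_prob//; last by move=> x; rewrite lee_fin sqr_ge0.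
apply: (@le_lt_trans _ _
  (\int[mu]_x (4 * Num.sqrt 2 * normal_pdf 0 (Num.sqrt 2) x)%:E)%E).
  apply: ge0_le_integral => //=.
  - by move=> x _; rewrite lee_fin mulr_ge0 ?sqr_ge0 ?normal_pdf_ge0.
  - apply/measurable_EFinP; apply: measurable_funM; first exact: measurable_funX.
    exact: measurable_normal_pdf.
  - apply/measurable_EFinP; apply: measurable_funM => //.
    exact: measurable_normal_pdf.
  - by move=> x _; rewrite -EFinM lee_fin sqr_normal_pdf_le.
under eq_integral do rewrite EFinM.
rewrite integralZl//; last exact: integrable_normal_pdf.
by rewrite integral_normal_pdf mule1 ltry.
Qed.

Lemma normal_peak_scale s : 0 < s -> normal_peak s = s^-1 * normal_peak 1.
Proof.
move=> s0; rewrite /normal_peak expr1n mul1r -mulrnAr sqrtrM ?sqr_ge0//.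
by rewrite sqrtr_sqr ger0_norm ?ltW// invfM.
Qed.

Lemma normal_second_moment s : 0 < s ->
  (\int[normal_prob 0 s]_x (x ^+ 2)%:E =
   (s ^+ 2)%:E * \int[normal_prob 0 1]_x (x ^+ 2)%:E)%E.
Proof.
move=> s0; have sn0 : s != 0 by rewrite gt_eqF.
have mX : measurable_fun [set: R] (fun x : R => (x ^+ 2)%:E).
  by apply/measurable_EFinP; exact: measurable_funX.
rewrite !ge0_integral_normal_prob//; try by move=> x; rewrite lee_fin sqr_ge0.
under [in RHS]eq_integral do rewrite -EFinM.
pose F (x : R^o) : R^o := x * s^-1.
have F'E : (F^`())%classic = cst s^-1.
  apply/funext => x; rewrite /F derive1E deriveM// derive_id derive_cst.
  by rewrite scaler0 add0r scaler1.
(* Substituting [x / s] in the standard moment gives the density of deviation [s], with [s^2] left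
   over from rescaling the square. *)
rewrite (@increasing_ge0_integration_by_substitutionT _ F
  (fun x => x ^+ 2 * normal_pdf 0 1 x))//.
- have mF : measurable_fun [set: R] (F : R -> R) by exact: measurable_funM.
  have mG : measurable_fun [set: R] (fun x : R => x ^+ 2 * normal_pdf 0 1 x).
    by apply: measurable_funM; [exact: measurable_funX|exact: measurable_normal_pdf].
  rewrite -ge0_integralZl//=; last 3 first.
  + apply/measurable_EFinP; rewrite F'E; apply: measurable_funM => //.
    exact: (measurableT_comp mG mF).
  + move=> x _; rewrite lee_fin F'E fctE /= mulr_ge0 ?invr_ge0 ?(ltW s0)//.
    by rewrite mulr_ge0 ?sqr_ge0 ?normal_pdf_ge0.
  + by rewrite lee_fin sqr_ge0.
  apply: eq_integral => x _; rewrite -!EFinM; congr EFin.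
  rewrite F'E fctE /= !normal_pdfE ?oner_eq0// normal_peak_scale// /normal_fun !subr0.
  have -> : - F x ^+ 2 / (1 ^+ 2 *+ 2) = - x ^+ 2 / (s ^+ 2 *+ 2).
    by rewrite /F; field.
  by rewrite /F; move: (normal_peak 1) (expR _) => q e; field.
- by move=> x y xy; rewrite /F ltr_pM2r// invr_gt0.
- by rewrite F'E => ?; exact: cvg_cst.
- by rewrite F'E; exact: is_cvg_cst.
- by rewrite F'E; exact: is_cvg_cst.
- apply/gt0_cvgMlNy; last exact: cvg_id.
  by rewrite invr_gt0.
- apply/gt0_cvgMly; last exact: cvg_id.
  by rewrite invr_gt0.
- move=> x; apply: (@cvgM _ R^o); first exact: exprn_continuous.
  by apply: continuous_normal_pdf; rewrite oner_eq0.
- by move=> x; rewrite mulr_ge0 ?sqr_ge0 ?normal_pdf_ge0.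
Qed.

End normal_moments.

(** * Second moments of combinations of independent normal variables *)

Lemma second_moment_centered_normal {R : realType} (dT : measure_display)
    (T : measurableType dT) (P : probability T R) (X : T -> R) (v : R) :
  measurable_fun [set: T] X -> 0 < v -> is_centered_normal P X v ->
  (\int[P]_t (X t ^+ 2)%:E = v%:E * \int[normal_prob 0 1]_x (x ^+ 2)%:E)%E.
Proof.
move=> mX v0 lawX.
have mf : measurable_fun [set: R] (fun x : R => (x ^+ 2)%:E).
  by apply/measurable_EFinP; exact: measurable_funX.
rewrite -[in RHS](sqr_sqrtr (ltW v0)) -normal_second_moment ?sqrtr_gt0//.
transitivity (\int[P]_(t in X @^-1` setT) ((fun x => (x ^+ 2)%:E) \o
    (X : T -> measurableTypeR R)) t)%E.
  by rewrite preimage_setT.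
rewrite -(@ge0_integral_pushforward _ _ _ (measurableTypeR R))//=; last first.
  by move=> x _; rewrite lee_fin sqr_ge0.
by apply: eq_measure_integral => //= A mA _; exact: lawX.
Qed.

(* (X, Y) and (- X, Y) have the same law, hence E[X Y] = - E[X Y]. *)
Lemma centered_normal_uncorrelated {R : realType} (dT : measure_display)
    (T : measurableType dT) (P : probability T R) (X Y : T -> R) (v w : R) :
  measurable_fun [set: T] X -> measurable_fun [set: T] Y -> 0 < v ->
  is_centered_normal P X v -> is_centered_normal P Y w ->
  (forall A B, measurable A -> measurable B ->
    P (X @^-1` A `&` Y @^-1` B) = (P (X @^-1` A) * P (Y @^-1` B))%E) ->
  P.-integrable setT (fun t => (X t * Y t)%:E) ->
  (\int[P]_t (X t * Y t)%:E = 0)%E.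
Proof.
move=> mX mY v0 lawX lawY indep intXY.
pose T2 : measurableType _ := (measurableTypeR R * measurableTypeR R)%type.
pose f (p : T2) := (p.1 * p.2)%:E : \bar R.
have mf : measurable_fun [set: T2] f.
  by apply/measurable_EFinP; apply: measurable_funM.
pose phi t : T2 := (X t, Y t); pose psi t : T2 := (- X t, Y t).
have mphi : measurable_fun [set: T] phi by exact/measurable_fun_pair.
have mNX : measurable_fun [set: T] (fun t => - X t) by exact: measurableT_comp.
have mpsi : measurable_fun [set: T] psi by exact/measurable_fun_pair.
have intf : P.-integrable (phi @^-1` setT) (f \o phi) by rewrite preimage_setT.
have intg : P.-integrable (psi @^-1` setT) (f \o psi).
  rewrite preimage_setT; apply: eq_integrable (integrableN intXY) => //.
  by move=> t _; rewrite /f /= mulNr.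
have E1 := integral_pushforward mphi mf intf measurableT.
have E2 := integral_pushforward mpsi mf intg measurableT.
have s0 : Num.sqrt v != 0 by rewrite gt_eqF ?sqrtr_gt0.
(* By independence both image laws agree on rectangles with the same product of normal laws, the
   reflected normal being itself; uniqueness of the product measure identifies them. *)
have e : (\int[pushforward P psi]_y f y = \int[pushforward P phi]_y f y)%E.
  apply: eq_measure_integral => /= A mA _.
  transitivity ((normal_prob 0 (Num.sqrt v) \x normal_prob 0 (Num.sqrt w))%E A).
    apply/esym; apply: product_measure_unique => //= B C mB mC.
    have mNB : measurable (-%R @^-1` B : set R).
      rewrite -[X in measurable X]setTI.
      exact: (measurable_funN (@measurable_id _ _ setT) measurableT mB).
    rewrite /pushforward (_ : _ @^-1` _ = X @^-1` (-%R @^-1` B) `&` Y @^-1` C)//.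
    by rewrite indep// lawX// lawY// normal_probN.
  apply: product_measure_unique => //= B C mB mC.
  rewrite /pushforward (_ : _ @^-1` _ = X @^-1` B `&` Y @^-1` C)//.
  by rewrite indep// lawX// lawY.
move: e; rewrite E1 E2 !preimage_setT /f /= .
under eq_integral do rewrite mulNr EFinN.
rewrite integralN; last exact: integrable_add_def.
have /fineK <- := integrable_fin_num measurableT intXY.
by rewrite -EFinN => -[]; set r := fine _ => rN; congr EFin; lra.
Qed.

Lemma mutually_independent_pair {R : realType} (dT : measure_display)
    (T : measurableType dT) (P : probability T R) (I : finType)
    (nu : I -> T -> R) (a b : I) (A B : set R) :
  mutually_independent P nu -> a != b -> measurable A -> measurable B ->
  P (nu a @^-1` A `&` nu b @^-1` B) = (P (nu a @^-1` A) * P (nu b @^-1` B))%E.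
Proof.
move=> [_ indep] ab mA mB.
(* Independence quantifies over families of measurable sets on all indices; only the values at [a]
   and [b] enter for the subset [{a, b}]. *)
pose F i := if i == a then A else if i == b then B else setT.
have mF i : measurable (F i) by rewrite /F; case: ifP => // _; case: ifP.
have ba : b == a = false by rewrite eq_sym (negbTE ab).
have := indep [set a; b]%SET F mF.
rewrite big_setU1 ?inE//= big_set1 /F eqxx ba eqxx => <-; congr (P _).
apply/seteqP; split => t /=.
  move=> [ta tb] i /=; rewrite !inE => /orP[|] /eqP ->; rewrite ?eqxx//.
  by rewrite ba.
move=> h; split.
  by have := h a (set21 a b); rewrite /= eqxx.
by have := h b (set22 a b); rewrite /= ba eqxx.
Qed.

Lemma second_moment_combination {R : realType} (dT : measure_display)
    (T : measurableType dT) (P : probability T R) (I : finType)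
    (nu : I -> T -> R) (v m : I -> R) :
  mutually_independent P nu -> (forall a, 0 < v a) ->
  (forall a, is_centered_normal P (nu a) (v a)) ->
  (\int[P]_t ((\sum_a m a * nu a t) ^+ 2)%:E =
   (\sum_a v a * m a ^+ 2)%:E * \int[normal_prob 0 1]_x (x ^+ 2)%:E)%E.
Proof.
move=> indep v0 law.
have mnu a : measurable_fun [set: T] (nu a) by have [+ _] := indep.
have int2 a : P.-integrable setT (fun t => (nu a t ^+ 2)%:E).
  apply/integrableP; split.
    by apply/measurable_EFinP; exact: measurable_funX.
  under eq_integral do rewrite gee0_abs ?lee_fin ?sqr_ge0//.
  rewrite (second_moment_centered_normal _ _ _ _ (v a))//.
  by rewrite lte_mul_pinfty ?lee_fin ?(ltW (v0 a))// normal_second_moment_lty.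
(* Domination by the two squares: [|x y| <= x^2 + y^2]. *)
have intM a b : P.-integrable setT (fun t => (nu a t * nu b t)%:E).
  apply: le_integrable (integrableD measurableT (int2 a) (int2 b)) => //.
    by apply/measurable_EFinP; exact: measurable_funM.
  move=> t _ /=; rewrite lee_fin.
  have : 0 <= (nu a t + nu b t) ^+ 2 by exact: sqr_ge0.
  have : 0 <= (nu a t - nu b t) ^+ 2 by exact: sqr_ge0.
  rewrite [`|_ + _|]ger0_norm ?addr_ge0 ?sqr_ge0// ler_norml => h1 h2.
  by apply/andP; split; nra.
have E2 a b : (\int[P]_t (nu a t * nu b t)%:E =
    (if a == b then v a else 0)%:E * \int[normal_prob 0 1]_x (x ^+ 2)%:E)%E.
  case: eqVneq => [<-|ab].
    rewrite -(second_moment_centered_normal _ _ P (nu a))//.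
  rewrite mul0e; apply: (centered_normal_uncorrelated _ _ _ _ _ (v a) (v b)) => //.
  move=> A B mA mB; exact: mutually_independent_pair.
transitivity (\int[P]_t \sum_a \sum_b (m a * m b)%:E * (nu a t * nu b t)%:E)%E.
  apply: eq_integral => t _; rewrite expr2 big_distrlr /= -sumEFin.
  apply: eq_bigr => a _; rewrite -sumEFin; apply: eq_bigr => b _.
  by rewrite -EFinM; congr EFin; ring.
have intZ a b : P.-integrable setT (fun t => (m a * m b)%:E * (nu a t * nu b t)%:E)%E.
  exact: integrableZl.
have C : (\int[@normal_prob R 0 1]_x (x ^+ 2)%:E)%E \is a fin_num.
  rewrite ge0_fin_numE ?normal_second_moment_lty// integral_ge0// => x _.
  by rewrite lee_fin sqr_ge0.
rewrite integral_sum//; last by move=> a; exact: integrable_sum.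
(* The finite moment becomes a real [K], so that distributivity is that of the reals. *)
move: E2; rewrite -(fineK C); move: (fine _) => K E2.
rewrite -EFinM mulr_suml -sumEFin; apply: eq_bigr => a _.
rewrite integral_sum// (bigD1 a)//= big1 ?adde0 => [|b ba].
  rewrite integralZl// E2 eqxx -!EFinM; congr EFin; ring.
by rewrite integralZl// E2 eq_sym (negbTE ba) -!EFinM mul0r mulr0.
Qed.

Lemma second_moment_sqnorm_combination {R : realType} (dT : measure_display)
    (T : measurableType dT) (P : probability T R) (I : finType) (q : nat)
    (nu : I -> T -> R) (v : I -> R) (M : I -> 'cV[R]_q) :
  mutually_independent P nu -> (forall a, 0 < v a) ->
  (forall a, is_centered_normal P (nu a) (v a)) ->
  (\int[P]_t (sqnorm (\sum_a nu a t *: M a))%:E =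
   (\sum_a v a * sqnorm (M a))%:E * \int[normal_prob 0 1]_x (x ^+ 2)%:E)%E.
Proof.
move=> indep v0 law.
have mnu a : measurable_fun [set: T] (nu a) by have [+ _] := indep.
transitivity (\int[P]_t \sum_(k < q) ((\sum_a M a k 0 * nu a t) ^+ 2)%:E)%E.
  apply: eq_integral => t _; rewrite sumEFin; congr EFin; apply: eq_bigr => k _.
  congr (_ ^+ 2); rewrite summxE; apply: eq_bigr => a _.
  by rewrite mxE mulrC.
rewrite ge0_integral_sum//=; last 2 first.
- move=> k; apply/measurable_EFinP; apply: measurable_funX.
  by apply: measurable_sum => a; exact: measurable_funM.
- by move=> k t _; rewrite lee_fin sqr_ge0.
under eq_bigr do rewrite (second_moment_combination _ _ _ _ _ v)//.
rewrite -ge0_sume_distrl; last first.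
  move=> k _; rewrite lee_fin sumr_ge0// => a _.
  by rewrite mulr_ge0 ?sqr_ge0 ?(ltW (v0 a)).
congr (_ * _)%E; rewrite sumEFin exchange_big /=; congr EFin.
by apply: eq_bigr => a _; rewrite -mulr_sumr.
Qed.

(** * The weights, and the Euclidean inner product *)

Lemma sum_delta {R : pzSemiRingType} (I : finType) (i : I) (Q : pred I) (F : I -> R) :
  \sum_(i' | Q i') (i' == i)%:R * F i' = (Q i)%:R * F i.
Proof.
rewrite big_mkcond (bigD1 i)//= big1 ?addr0 => [|i' /negbTE ->].
  by rewrite eqxx; case: (Q i); rewrite ?mul1r ?mul0r.
by rewrite mul0r if_same.
Qed.

(* Eliminating om and h successively from the two linear equations gives
   closed forms; mu is then fixed by normalization. *)
Lemma blup_weights {R : realType} (n k : nat) (c : 'I_n -> 'I_k) (i : 'I_n)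
    (a g : 'I_n -> R) (lam : R) :
  (forall i', 0 < a i') -> (forall i', 0 < g i') -> 0 < lam ->
  exists (h : 'I_n -> R) (om : 'I_k -> R) (mu : R),
    [/\ \sum_i' h i' = 1,
        forall i', g i' * (h i' / a i' - om (c i')) = (i' == i)%:R - h i' &
        forall j, lam * (om j - mu) = \sum_(i' | c i' == j) ((i' == i)%:R - h i')].
Proof.
move=> a0 g0 lam0.
(* The first equation gives [h = p (om + delta / g)]. Inserted in the second, it gives [om_j (P_j +
   lam) = lam mu + [j = c i] (1 - p_i / g_i)], whence [q] and [kap]. *)
pose p i' := a i' * g i' / (a i' + g i').
have p0 i' : 0 < p i' by rewrite /p divr_gt0 ?mulr_gt0 ?addr_gt0.
pose Pj j := \sum_(i' | c i' == j) p i'.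
have Pj0 j : 0 <= Pj j by apply: sumr_ge0 => i' _; exact: ltW.
pose q j := lam / (Pj j + lam).
have q0 j : 0 < q j by rewrite divr_gt0 ?ltr_wpDl.
pose S := \sum_i' q (c i') * p i'.
have S0 : 0 < S.
  rewrite /S (bigD1 i)//=; apply: ltr_wpDr; last exact: mulr_gt0.
  by apply: sumr_ge0 => i' _; rewrite mulr_ge0 ?ltW.
pose kap := (1 - p i / g i) / lam.
(* The sum of the [h] is [S mu + P q kap + p_i / g_i], with [P] and [q] taken at the cluster of [i];
   solving for the value 1 gives [mu]. *)
pose mu := (1 - p i / g i - Pj (c i) * q (c i) * kap) / S.
pose om j := q j * (mu + (j == c i)%:R * kap).
pose h i' := p i' * (om (c i') + (i' == i)%:R / g i').
exists h, om, mu; split.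
- have -> : \sum_i' h i' = \sum_i' (q (c i') * p i' * mu) +
     \sum_i' (if c i' == c i then q (c i) * kap * p i' else 0) +
     \sum_i' (i' == i)%:R * (p i' / g i').
    rewrite -!big_split; apply: eq_bigr => i' _; rewrite /h /om /=.
    by have [->|_] := eqVneq (c i') (c i); rewrite /=; ring.
  rewrite sum_delta mul1r -mulr_suml -/S -big_mkcond -mulr_sumr -/(Pj (c i)).
  rewrite /mu; field; by rewrite !lt0r_neq0.
- move=> i'; rewrite /h /p; have := g0 i'; have := a0 i'.
  have := addr_gt0 (a0 i') (g0 i').
  move=> /lt0r_neq0 ag /lt0r_neq0 an /lt0r_neq0 gn.
  by field; rewrite gn ag an.
- move=> j; have Pl : Pj j + lam != 0 by rewrite gt_eqF ?ltr_wpDl.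
  have ln := lt0r_neq0 lam0.
  have -> : \sum_(i' | c i' == j) ((i' == i)%:R - h i') =
      \sum_(i' | c i' == j) (i' == i)%:R * (1 - p i' / g i') - om j * Pj j.
    rewrite /Pj mulr_sumr -sumrB; apply: eq_bigr => i' /eqP <-; rewrite /h; ring.
  rewrite sum_delta eq_sym /om /q /kap.
  by field; rewrite ln Pl lt0r_neq0.
Qed.

Definition dotv {R : realType} {m : nat} (u v : 'cV[R]_m) : R := (u^T *m v) 0 0.

Section dot.
Context {R : realType}.

Lemma sqnormE {m} (u : 'cV[R]_m) : sqnorm u = dotv u u.
Proof. by rewrite /dotv mxE; apply: eq_bigr => r _; rewrite mxE expr2. Qed.

Lemma dotvC {m} (u v : 'cV[R]_m) : dotv u v = dotv v u.
Proof. by rewrite /dotv !mxE; apply: eq_bigr => r _; rewrite !mxE mulrC. Qed.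

Lemma dotvDl {m} (u w v : 'cV[R]_m) : dotv (u + w) v = dotv u v + dotv w v.
Proof. by rewrite /dotv linearD mulmxDl mxE. Qed.

Lemma dotvBl {m} (u w v : 'cV[R]_m) : dotv (u - w) v = dotv u v - dotv w v.
Proof. by rewrite /dotv linearB mulmxBl !mxE. Qed.

Lemma dotvZl {m} s (u v : 'cV[R]_m) : dotv (s *: u) v = s * dotv u v.
Proof. by rewrite /dotv linearZ -scalemxAl mxE. Qed.

Lemma dotvDr {m} (u w v : 'cV[R]_m) : dotv v (u + w) = dotv v u + dotv v w.
Proof. by rewrite dotvC dotvDl !(dotvC _ v). Qed.

Lemma dotvZr {m} s (u v : 'cV[R]_m) : dotv u (s *: v) = s * dotv u v.
Proof. by rewrite dotvC dotvZl dotvC. Qed.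

Lemma dotv_suml {m} (I : finType) (Q : pred I) (F : I -> 'cV[R]_m) v :
  dotv (\sum_(x | Q x) F x) v = \sum_(x | Q x) dotv (F x) v.
Proof. by rewrite /dotv linear_sum mulmx_suml summxE. Qed.

Lemma dotv_mulmxr {m p} (A : 'M[R]_(m, p)) (u : 'cV[R]_m) (v : 'cV[R]_p) :
  dotv u (A *m v) = dotv (A^T *m u) v.
Proof. by rewrite /dotv trmx_mul trmxK mulmxA. Qed.

Lemma sqnorm_ge0 {m} (u : 'cV[R]_m) : 0 <= sqnorm u.
Proof. by apply: sumr_ge0 => r _; exact: sqr_ge0. Qed.

Lemma sqnorm_eq0 {m} (u : 'cV[R]_m) : sqnorm u = 0 -> u = 0.
Proof.
move=> /eqP; rewrite psumr_eq0 => [/allP u0|r _]; last exact: sqr_ge0.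
apply/colP => r; rewrite mxE; apply/eqP.
by have := u0 r (mem_index_enum r); rewrite sqrf_eq0.
Qed.

Lemma sqnormDZ {m} s (u v : 'cV[R]_m) :
  sqnorm (u + s *: v) = sqnorm u + s * (2 * dotv u v) + s ^+ 2 * sqnorm v.
Proof.
by rewrite !sqnormE !dotvDl !dotvDr !dotvZl !dotvZr (dotvC v u); ring.
Qed.

Lemma sum_dotv_col {m p} (A B : 'M[R]_(m, p)) :
  \sum_r dotv (col r A) (col r B) = \tr (A^T *m B).
Proof.
apply: eq_bigr => r _; rewrite /dotv !mxE; apply: eq_bigr => l _.
by rewrite !mxE.
Qed.

Lemma mulmx_sum_col {m p} (A : 'M[R]_(m, p)) (u : 'cV[R]_p) :
  A *m u = \sum_r u r 0 *: col r A.
Proof.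
apply/colP => l; rewrite mxE summxE; apply: eq_bigr => r _.
by rewrite !mxE mulrC.
Qed.

End dot.

(** At [s = - L / (1 + |Q|)] the polynomial is at most [- (L / (1 + |Q|))^2], which forces [L = 0].
    The added 1 keeps the denominator positive when [Q = 0]. *)
Lemma linear_coef_eq0 {R : realType} (L Q : R) :
  (forall s, 0 <= s * L + s ^+ 2 * Q) -> L = 0.
Proof.
move=> H.
have := H (- L / (1 + `|Q|)); set s := _ / _ => Hs.
have q0 : 0 < 1 + `|Q| by rewrite ltr_wpDr.
have : s * L + s ^+ 2 * Q <= s * L + s ^+ 2 * `|Q|.
  by rewrite lerD2l ler_wpM2l ?sqr_ge0// ler_norm.
move=> /(le_trans Hs).
have -> : s * L + s ^+ 2 * `|Q| = - ((L / (1 + `|Q|)) ^+ 2).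
  by rewrite /s; field; exact: lt0r_neq0.
rewrite oppr_ge0 => L0.
have /eqP : (L / (1 + `|Q|)) ^+ 2 = 0 by apply/eqP; rewrite eq_le L0 sqr_ge0.
by rewrite sqrf_eq0 mulf_eq0 invr_eq0 (gt_eqF q0) orbF => /eqP.
Qed.

(** * The minimizer *)

Section deterministic.
Context {R : realType} {n k d : nat} {ni : 'I_n -> nat} (c : 'I_n -> 'I_k).
Context (X : forall i : 'I_n, 'M[R]_(ni i, d)).

Definition hobjective_deriv (s2 : 'I_n -> R) (lam : 'I_k -> R) (gam : 'I_n -> R)
    (y : forall i, 'cV[R]_(ni i)) (th : 'I_n -> 'cV[R]_d) (w : 'I_k -> 'cV[R]_d)
    (wb : 'cV[R]_d) (dth : 'I_n -> 'cV[R]_d) (dw : 'I_k -> 'cV[R]_d)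
    (dwb : 'cV[R]_d) : R :=
  \sum_(j < k) (lam j * dotv (w j - wb) (dw j - dwb) +
    \sum_(i < n | c i == j)
      (gam i * dotv (th i - w j) (dth i - dw j) -
       (s2 i)^-1 * dotv (y i - X i *m th i) (X i *m dth i))).

(** Squared norms of affine maps have an exact second-order expansion along a line. The quadratic
    term sees only the linear parts, hence the objective with zero data. *)
Lemma hobjectiveDZ s2 lam gam y th w wb dth dw dwb (s : R) :
  (forall i, s2 i != 0) ->
  hobjective c X s2 lam gam y (fun i => th i + s *: dth i)
    (fun j => w j + s *: dw j) (wb + s *: dwb) =
  hobjective c X s2 lam gam y th w wb +
  s * hobjective_deriv s2 lam gam y th w wb dth dw dwb +
  s ^+ 2 * hobjective c X s2 lam gam (fun=> 0) dth dw dwb.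
Proof.
move=> s20; rewrite /hobjective /hobjective_deriv !mulr_sumr -!big_split /=.
apply: eq_bigr => j _.
rewrite [s * (_ + _)]mulrDr [s ^+ 2 * (_ + _)]mulrDr.
rewrite [s * \sum_(_ | _) _]mulr_sumr [s ^+ 2 * \sum_(_ | _) _]mulr_sumr.
have -> : w j + s *: dw j - (wb + s *: dwb) = (w j - wb) + s *: (dw j - dwb).
  by rewrite scalerBr opprD addrACA.
rewrite sqnormDZ.
under eq_bigr => i _.
  have -> : th i + s *: dth i - (w j + s *: dw j) = (th i - w j) + s *: (dth i - dw j).
    by rewrite scalerBr opprD addrACA.
  have -> : y i - X i *m (th i + s *: dth i) =
      (y i - X i *m th i) + s *: (0 - X i *m dth i).
    by rewrite mulmxDr opprD addrA -scalemxAr sub0r scalerN.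
  rewrite !sqnormDZ.
  have -> : dotv (y i - X i *m th i) (0 - X i *m dth i) =
      - dotv (y i - X i *m th i) (X i *m dth i).
    by rewrite dotvC sub0r -scaleN1r dotvZl mulN1r dotvC.
  have -> : forall A B C D E F : R,
    (2 * s2 i)^-1 * (A + s * (2 * - B) + s ^+ 2 * C) +
      gam i / 2 * (D + s * (2 * E) + s ^+ 2 * F) =
    ((2 * s2 i)^-1 * A + gam i / 2 * D) + s * (gam i * E - (s2 i)^-1 * B) +
    s ^+ 2 * ((2 * s2 i)^-1 * C + gam i / 2 * F).
    by move=> *; field.
  over.
rewrite !big_split /=; set S1 := \sum_(_ | _) _; set S2 := \sum_(_ | _) _.
set S3 := \sum_(_ | _) s ^+ 2 * _.
by field.
Qed.

Lemma hobjective_minimizer_deriv s2 lam gam y th w wb dth dw dwb :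
  (forall i, s2 i != 0) ->
  (forall th' w' wb', hobjective c X s2 lam gam y th w wb <=
    hobjective c X s2 lam gam y th' w' wb') ->
  hobjective_deriv s2 lam gam y th w wb dth dw dwb = 0.
Proof.
move=> s20 min.
apply: (@linear_coef_eq0 _ _ (hobjective c X s2 lam gam (fun=> 0) dth dw dwb)) => s.
have := min (fun i => th i + s *: dth i) (fun j => w j + s *: dw j) (wb + s *: dwb).
by rewrite hobjectiveDZ// -addrA lerDl.
Qed.

Lemma hobjective_minimizer_theta (i : 'I_n) s2 lam gam beta y th w wb h om mu :
  (forall i', 0 < s2 i') -> (forall i', 0 < beta i') ->
  (forall i', (X i')^T *m X i' = (beta i')%:M) ->
  (forall th' w' wb', hobjective c X s2 (fun=> lam) gam y th w wb <=
    hobjective c X s2 (fun=> lam) gam y th' w' wb') ->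
  \sum_i' h i' = 1 ->
  (forall i', gam i' * (h i' / (beta i' / s2 i') - om (c i')) = (i' == i)%:R - h i') ->
  (forall j, lam * (om j - mu) = \sum_(i' | c i' == j) ((i' == i)%:R - h i')) ->
  th i = \sum_i' h i' *: ((beta i')^-1 *: ((X i')^T *m y i')).
Proof.
move=> s20 b0 hX min h1 hom homu.
have s2n i' : s2 i' != 0 by exact: lt0r_neq0.
have bn i' : beta i' != 0 by exact: lt0r_neq0.
pose thd i' := (beta i')^-1 *: ((X i')^T *m y i').
pose v := th i - \sum_i' h i' *: thd i'.
suff : dotv v v = 0.
  by rewrite -sqnormE => /sqnorm_eq0/eqP; rewrite subr_eq0 => /eqP.
rewrite -(hobjective_minimizer_deriv _ _ _ _ _ _ _
  (fun i' => (h i' / (beta i' / s2 i')) *: v) (fun j => om j *: v) (mu *: v) s2n min).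
(* Only the first [v] keeps its definition; the others become an arbitrary direction [u], in which
   both sides are linear. *)
rewrite /hobjective_deriv; move: {2 3 4 5 6 7}v => u.
have dX i' : dotv (y i' - X i' *m th i') (X i' *m ((h i' / (beta i' / s2 i')) *: u)) =
    s2 i' * h i' * dotv (thd i' - th i') u.
  rewrite dotv_mulmxr dotvZr mulmxBr mulmxA hX mul_scalar_mx.
  have -> : (X i')^T *m y i' = beta i' *: thd i' by rewrite scalerA mulfV ?scale1r.
  rewrite -scalerBr dotvZl; field.
  by rewrite s2n bn.
(* The equation for [lam * (om j - mu)] spreads each cluster term over its clients, where [w_j]
   cancels. The remaining [wbar] term vanishes after summation because the weights sum to 1. *)
transitivity (\sum_(j < k) \sum_(i' | c i' == j)
    ((i' == i)%:R * dotv (th i') u - h i' * dotv (thd i') u -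
     ((i' == i)%:R - h i') * dotv wb u)); last first.
  apply: eq_bigr => j _; rewrite -scalerBl dotvZr mulrA homu mulr_suml -big_split /=.
  apply: eq_bigr => i' /eqP <-.
  rewrite dX -scalerBl dotvZr (mulrA (gam _)) hom !dotvBl !mulrA mulVf// mul1r.
  by ring.
transitivity (\sum_i'
    ((i' == i)%:R * dotv (th i') u - h i' * dotv (thd i') u -
     ((i' == i)%:R - h i') * dotv wb u)); last by rewrite (partition_big c xpredT).
rewrite !sumrB -mulr_suml sumrB h1.
have -> : \sum_i' (i' == i)%:R = 1 :> R.
  under eq_bigr do rewrite -[_%:R]mulr1.
  by rewrite sum_delta mulr1.
rewrite sum_delta mul1r subrr mul0r subr0 {1}/v dotvBl dotv_suml.
by under [in LHS]eq_bigr do rewrite dotvZl.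
Qed.

End deterministic.

(** * Optimality of the weights *)

Lemma sum_noise_index {V : nmodType} {n k d : nat} {ni : 'I_n -> nat}
    (F : noise_index k d ni -> V) :
  \sum_a F a = \sum_j \sum_r F (inl (inl (j, r))) +
    \sum_i \sum_r F (inl (inr (i, r))) +
    \sum_i \sum_r F (inr (existT (fun i => 'I_(ni i)) i r)).
Proof.
rewrite big_sumType big_sumType /=; congr (_ + _ + _).
- by rewrite pair_bigA; apply: eq_bigr => -[].
- by rewrite pair_bigA; apply: eq_bigr => -[].
- by rewrite sig_big_dep /=; apply: eq_bigr => -[].
Qed.

Section optimality.
Context {R : realType} {n k d : nat} {ni : 'I_n -> nat} (c : 'I_n -> 'I_k).
Context (X : forall i : 'I_n, 'M[R]_(ni i, d)) (i : 'I_n).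

(** Coefficients of the noise coordinates in the error of the estimator with client matrices [K]. A
    cluster noise reaches all clients of its cluster, so their contributions add up; the delta term
    subtracts the target parameter of client [i]. *)
Definition error_coef (K : forall i', 'M[R]_(d, ni i'))
    (a : noise_index k d ni) : 'cV[R]_d :=
  match a with
  | inl (inl (j, r)) =>
      col r (\sum_(i' | c i' == j) (K i' *m X i' - ((i' == i)%:R)%:M))
  | inl (inr (i', r)) => col r (K i' *m X i' - ((i' == i)%:R)%:M)
  | inr (existT i' r) => col r (K i')
  end.

Lemma error_decomposition {T : Type} (K : forall i', 'M[R]_(d, ni i'))
    (thbar : 'cV[R]_d) (xib : 'I_k -> T -> 'cV[R]_d) (xi : 'I_n -> T -> 'cV[R]_d)
    (eps : forall i : 'I_n, T -> 'cV[R]_(ni i)) (t : T) :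
  \sum_i' K i' *m X i' = 1%:M ->
  \sum_i' K i' *m (X i' *m (thbar + xib (c i') t + xi i' t) + eps i' t) -
    (thbar + xib (c i) t + xi i t) =
  \sum_a noise_coord xib xi eps a t *: error_coef K a.
Proof.
move=> K1; rewrite sum_noise_index /=.
rewrite -(eq_bigr _ (fun j _ => mulmx_sum_col _ (xib j t))).
rewrite -(eq_bigr _ (fun i' _ => mulmx_sum_col _ (xi i' t))).
rewrite -(eq_bigr _ (fun i' _ => mulmx_sum_col _ (eps i' t))).
(* The target is written as a sum over all clients so that it merges termwise with the estimator. *)
have dM (v : 'I_n -> 'cV[R]_d) : v i = \sum_i' ((i' == i)%:R)%:M *m v i'.
  rewrite (bigD1 i)//= big1 ?addr0 ?eqxx ?mul1mx// => i' /negbTE ->.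
  by rewrite mul_scalar_mx scale0r.
have -> : \sum_j (\sum_(i' | c i' == j) (K i' *m X i' - ((i' == i)%:R)%:M)) *m xib j t =
    \sum_i' (K i' *m X i' - ((i' == i)%:R)%:M) *m xib (c i') t.
  rewrite [RHS](partition_big c xpredT)//=; apply: eq_bigr => j _.
  by rewrite mulmx_suml; apply: eq_bigr => i' /eqP ->.
rewrite (dM (fun i' => thbar + xib (c i') t + xi i' t)) -sumrB.
(* Unbiasedness removes the unknown mean from the error. *)
have tb0 : \sum_i' (K i' *m X i' - ((i' == i)%:R)%:M) *m thbar = 0.
  rewrite -mulmx_suml sumrB K1 mulmxBl mul1mx mulmx_suml.
  by rewrite -(dM (fun=> thbar)) subrr.
rewrite -[RHS]add0r -[X in X + _]tb0 -!big_split /=; apply: eq_bigr => i' _.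
by rewrite !addrA -!mulmxDr mulmxDr mulmxA mulmxBl addrAC.
Qed.

(** Pythagoras for the inner product weighted by the noise variances: the difference of the two
    coefficient families is orthogonal to that of [K], so it only adds a nonnegative term. *)
Lemma error_coef_optimal (sbar2 : R) (sc2 : 'I_k -> R) (s2 : 'I_n -> R) beta
    (h : 'I_n -> R) om mu (K K' : forall i', 'M[R]_(d, ni i')) :
  0 < sbar2 -> (forall j, 0 < sc2 j) -> (forall i, 0 < s2 i) ->
  (forall i', 0 < beta i') -> (forall i', (X i')^T *m X i' = (beta i')%:M) ->
  \sum_i' h i' = 1 ->
  (forall i', (sc2 (c i'))^-1 * (h i' / (beta i' / s2 i') - om (c i')) =
    (i' == i)%:R - h i') ->
  (forall j, sbar2^-1 * (om j - mu) = \sum_(i' | c i' == j) ((i' == i)%:R - h i')) ->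
  (forall i', K i' = (h i' / beta i') *: (X i')^T) ->
  \sum_i' K' i' *m X i' = 1%:M ->
  \sum_a noise_var sbar2 sc2 s2 c a * sqnorm (error_coef K a) <=
  \sum_a noise_var sbar2 sc2 s2 c a * sqnorm (error_coef K' a).
Proof.
move=> sb0 sc0 s20 b0 hX h1 hom homu KE K'1.
have bn i' : beta i' != 0 by exact: lt0r_neq0.
have KX i' : K i' *m X i' = (h i')%:M.
  by rewrite KE -scalemxAl hX scale_scalar_mx divfK.
pose D i' := K' i' - K i'.
pose tD i' := \tr (D i' *m X i').
(* Both families satisfy the same unbiasedness constraint, so their differences cancel in the
   sum. *)
have tD0 : \sum_i' tD i' = 0.
  rewrite /tD -linear_sum /= (_ : \sum_i' _ = 0) ?linear0//.
  under eq_bigr do rewrite mulmxBl KX.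
  rewrite sumrB K'1 -[X in _ - X](raddf_sum (@scalar_mx R d)) /= h1.
  by rewrite subrr.
pose E a : 'cV[R]_d := error_coef K' a - error_coef K a.
have colB m p (A B : 'M[R]_(m, p)) r : col r A - col r B = col r (A - B).
  by rewrite linearB.
have cross : \sum_a noise_var sbar2 sc2 s2 c a * dotv (error_coef K a) (E a) = 0.
  rewrite sum_noise_index /= /E /=.
  (* With [a = beta / s2], the observation, client and cluster noises weight [tD i'] by [h / a],
     [om - h / a] and [mu - om]. These telescope to [mu]. *)
  have -> : \sum_i' \sum_r s2 i' * dotv (col r (K i')) (col r (K' i') - col r (K i')) =
      \sum_i' h i' / (beta i' / s2 i') * tD i'.
    apply: eq_bigr => i' _; rewrite -mulr_sumr.
    under eq_bigr do rewrite colB.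
    rewrite sum_dotv_col {1}KE linearZ /= trmxK -scalemxAl mxtraceZ.
    rewrite mxtrace_mulC -/(tD i').
    by field; rewrite bn lt0r_neq0.
  have -> : \sum_i' \sum_r sc2 (c i') *
      dotv (col r (K i' *m X i' - ((i' == i)%:R)%:M))
        (col r (K' i' *m X i' - ((i' == i)%:R)%:M) -
         col r (K i' *m X i' - ((i' == i)%:R)%:M)) =
      \sum_i' (om (c i') - h i' / (beta i' / s2 i')) * tD i'.
    apply: eq_bigr => i' _; rewrite -mulr_sumr.
    under eq_bigr do rewrite colB.
    rewrite sum_dotv_col.
    have -> : K' i' *m X i' - ((i' == i)%:R)%:M - (K i' *m X i' - ((i' == i)%:R)%:M) =
        D i' *m X i' by rewrite mulmxBl opprB addrA subrK.
    rewrite KX -raddfB tr_scalar_mx mul_scalar_mx mxtraceZ -/(tD i') mulrA.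
    congr (_ * _).
    by rewrite -[h i' - _]opprB -hom mulrN mulrA divff ?lt0r_neq0// mul1r opprB.
  have -> : \sum_j \sum_r sbar2 *
      dotv (col r (\sum_(i' | c i' == j) (K i' *m X i' - ((i' == i)%:R)%:M)))
        (col r (\sum_(i' | c i' == j) (K' i' *m X i' - ((i' == i)%:R)%:M)) -
         col r (\sum_(i' | c i' == j) (K i' *m X i' - ((i' == i)%:R)%:M))) =
      \sum_i' (mu - om (c i')) * tD i'.
    rewrite [RHS](partition_big c xpredT)//=; apply: eq_bigr => j _.
    rewrite -mulr_sumr; under [X in sbar2 * X]eq_bigr do rewrite colB.
    rewrite sum_dotv_col.
    have -> : \sum_(i' | c i' == j) (K i' *m X i' - ((i' == i)%:R)%:M) =
        (\sum_(i' | c i' == j) (h i' - (i' == i)%:R))%:M.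
      by rewrite raddf_sum; apply: eq_bigr => i' _; rewrite KX raddfB.
    rewrite tr_scalar_mx mul_scalar_mx mxtraceZ mulrA.
    have -> : sbar2 * \sum_(i' | c i' == j) (h i' - (i' == i)%:R) = mu - om j.
      under eq_bigr do rewrite -opprB.
      by rewrite sumrN -homu mulrN mulrA divff ?lt0r_neq0// mul1r opprB.
    transitivity (\sum_(i' | c i' == j) (mu - om j) * tD i'); last first.
      by apply: eq_bigr => i' /eqP ->.
    rewrite -mulr_sumr; congr (_ * _).
    rewrite /tD -linear_sum /=; congr (\tr _).
    rewrite raddf_sum -sumrB; apply: eq_bigr => i' _.
    by rewrite raddfB /= -KX mulmxBl opprB addrA subrK.
  rewrite -!big_split /= -[RHS](mulr0 mu) -[X in _ = mu * X]tD0 mulr_sumr.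
  apply: eq_bigr => i' _.
  by ring.
have v0 a : 0 < noise_var sbar2 sc2 s2 c a by case: a => [[[j r]|[i' r]]|[i' r]] /=.
have -> : \sum_a noise_var sbar2 sc2 s2 c a * sqnorm (error_coef K' a) =
  \sum_a noise_var sbar2 sc2 s2 c a * sqnorm (error_coef K a) +
  2 * (\sum_a noise_var sbar2 sc2 s2 c a * dotv (error_coef K a) (E a)) +
  \sum_a noise_var sbar2 sc2 s2 c a * sqnorm (E a).
  rewrite mulr_sumr -!big_split; apply: eq_bigr => a _ /=.
  have -> : error_coef K' a = error_coef K a + 1 *: E a.
    by rewrite scale1r /E addrC subrK.
  by rewrite sqnormDZ; ring.
rewrite cross mulr0 addr0 lerDl sumr_ge0// => a _.
by rewrite mulr_ge0 ?sqnorm_ge0// ltW.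
Qed.

End optimality.

(** * Stacked estimators *)

Section stacked_estimator.
Context {R : realType} {n d : nat} {ni : 'I_n -> nat} (i : 'I_n).
Context (X : forall i : 'I_n, 'M[R]_(ni i, d)) (beta : 'I_n -> R).

(* An estimator of the stacked vector W_i, seen as acting on all the raw
   observations y_i'; the cast handles the own block, of height ni i. *)
Definition client_coef (L : 'M[R]_(d, ni i + \sum_(j < n.-1) d)) (i' : 'I_n) :
    'M[R]_(d, ni i') :=
  match i =P i' with
  | ReflectT e => castmx (erefl, congr1 ni e) (lsubmx L)
  | ReflectF _ =>
      (if unlift i i' is Some j then submxrow (rsubmx L) j else 0) *m
      ((beta i')^-1 *: (X i')^T)
  end.

Lemma client_coef_self L : client_coef L i = lsubmx L.
Proof.
rewrite /client_coef; case: eqP => // e.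
(* Equality proofs on ordinals are unique, so the cast is along [erefl]. *)
by rewrite (eq_irrelevance e erefl) castmx_id.
Qed.

Lemma client_coef_lift L j : client_coef L (lift i j) =
  submxrow (rsubmx L) j *m ((beta (lift i j))^-1 *: (X (lift i j))^T).
Proof.
rewrite /client_coef; case: eqP => [e|_]; last by rewrite liftK.
by have := neq_lift i j; rewrite {1}e eqxx.
Qed.

Lemma mul_stackW L (y : forall i' : 'I_n, 'cV[R]_(ni i')) :
  L *m stackW i (y i) (fun i' => (beta i')^-1 *: ((X i')^T *m y i')) =
  \sum_i' client_coef L i' *m y i'.
Proof.
rewrite (bigD1_ord i)//= client_coef_self.
rewrite -{1}(hsubmxK L) /stackW mul_row_col; congr (_ + _).
rewrite -{1}(submxrowK (rsubmx L)) mul_mxrow_mxcol; apply: eq_bigr => j _.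
by rewrite client_coef_lift -mulmxA -scalemxAl.
Qed.

(** Turns the stacked constraint into one on the client matrices: for another client,
    [X^T X = beta I] makes the local estimator a left inverse of its design matrix. *)
Lemma mul_stackZ L :
  (forall i', 0 < beta i') -> (forall i', (X i')^T *m X i' = (beta i')%:M) ->
  L *m stackZ i (X i) = \sum_i' client_coef L i' *m X i'.
Proof.
move=> b0 hX; rewrite (bigD1_ord i)//= client_coef_self.
rewrite -{1}(hsubmxK L) /stackZ mul_row_col; congr (_ + _).
rewrite -{1}(submxrowK (rsubmx L)) mul_mxrow_mxcol; apply: eq_bigr => j _.
rewrite client_coef_lift -mulmxA -scalemxAl hX scale_scalar_mx mulVf//.
exact: lt0r_neq0.
Qed.

(** The own block includes the local least-squares map because [W_i] holds the raw [y_i]; the other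
    clients are already reduced to local estimates and need only their scalar weight. *)
Definition weighted_stack (h : 'I_n -> R) : 'M[R]_(d, ni i + \sum_(j < n.-1) d) :=
  row_mx ((h i / beta i) *: (X i)^T) (\mxrow_(j < n.-1) (h (lift i j))%:M).

Lemma client_coef_weighted h i' :
  client_coef (weighted_stack h) i' = (h i' / beta i') *: (X i')^T.
Proof.
case: (unliftP i i') => [j|] ->; last by rewrite client_coef_self row_mxKl.
by rewrite client_coef_lift row_mxKr mxrowK mul_scalar_mx scalerA.
Qed.

End stacked_estimator.

(** * Risk of the minimizer against linear unbiased estimators *)

Theorem mainTheorem11
  (R : realType) (dT : measure_display) (T : measurableType dT)
  (P : probability T R)
  (n k d : nat) (ni : 'I_n -> nat) (c : 'I_n -> 'I_k)
  (c_surj : forall j : 'I_k, exists i : 'I_n, c i = j)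
  (sbar2 : R) (sc2 : 'I_k -> R) (s2 : 'I_n -> R)
  (hsbar2 : 0 < sbar2) (hsc2 : forall j, 0 < sc2 j) (hs2 : forall i, 0 < s2 i)
  (X : forall i : 'I_n, 'M[R]_(ni i, d)) (beta : 'I_n -> R)
  (hbeta : forall i, 0 < beta i)
  (hX : forall i, (X i)^T *m X i = (beta i)%:M)
  (thbar : 'cV[R]_d)
  (xib : 'I_k -> T -> 'cV[R]_d) (xi : 'I_n -> T -> 'cV[R]_d)
  (eps : forall i : 'I_n, T -> 'cV[R]_(ni i))
  (hindep : mutually_independent P (noise_coord xib xi eps))
  (hlaw : forall a, is_centered_normal P (noise_coord xib xi eps a)
                                         (noise_var sbar2 sc2 s2 c a))
  (thh : T -> 'I_n -> 'cV[R]_d) (wh : T -> 'I_k -> 'cV[R]_d) (wbh : T -> 'cV[R]_d)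
  (i : 'I_n) :
  let thbS := fun (t : T) (j : 'I_k) => thbar + xib j t in
  let thS := fun (t : T) (i' : 'I_n) => thbS t (c i') + xi i' t in
  let y := fun (t : T) (i' : 'I_n) => X i' *m thS t i' + eps i' t in
  let lam := fun _ : 'I_k => sbar2^-1 in
  let gam := fun i' : 'I_n => (sc2 (c i'))^-1 in
  let J := fun t => hobjective c X s2 lam gam (y t) in
  (forall t th w wbar, J t (thh t) (wh t) (wbh t) <= J t th w wbar) ->
  let thd := fun (t : T) (i' : 'I_n) =>
    invmx ((X i')^T *m X i') *m (X i')^T *m y t i' in
  let W := fun t => stackW i (y t i) (thd t) in
  let Z := stackZ i (X i) in
  exists Lstar : 'M[R]_(d, ni i + \sum_(j < n.-1) d),
    Lstar *m Z = 1%:M /\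
    (forall t, thh t i = Lstar *m W t) /\
    forall L : 'M[R]_(d, ni i + \sum_(j < n.-1) d),
      L *m Z = 1%:M ->
      (\int[P]_t (sqnorm (thh t i - thS t i))%:E <=
       \int[P]_t (sqnorm (L *m W t - thS t i))%:E)%E.
Proof.
move=> thbS thS y lam gam J min thd W Z.
have a0 i' : 0 < beta i' / s2 i' by rewrite divr_gt0.
have g0 i' : 0 < (sc2 (c i'))^-1 by rewrite invr_gt0.
have l0 : 0 < sbar2^-1 by rewrite invr_gt0.
have [h [om [mu [h1 hom homu]]]] := blup_weights n k c i _ _ _ a0 g0 l0.
have bn i' : beta i' != 0 by exact: lt0r_neq0.
have WE t (L : 'M[R]_(d, ni i + \sum_(j < n.-1) d)) :
    L *m W t = \sum_i' client_coef i X beta L i' *m y t i'.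
  rewrite -mul_stackW; congr (_ *m stackW _ _ _); apply/funext => i'.
  by rewrite /thd hX invmx_scalar -mulmxA mul_scalar_mx.
pose Ls := weighted_stack i X beta h.
have KE i' : client_coef i X beta Ls i' = (h i' / beta i') *: (X i')^T.
  exact: client_coef_weighted.
have LsZ : Ls *m Z = 1%:M.
  rewrite /Z (mul_stackZ i X beta)//.
  under eq_bigr do rewrite KE -scalemxAl hX scale_scalar_mx divfK//.
  by rewrite -(raddf_sum (@scalar_mx R d)) h1.
have thhE t : thh t i = Ls *m W t.
  rewrite WE (hobjective_minimizer_theta c X i s2 _ _ beta _ _ _ _ h om mu hs2
    hbeta hX (min t) h1 hom homu).
  by apply: eq_bigr => i' _; rewrite KE -scalemxAl scalerA.
have v0 a : 0 < noise_var sbar2 sc2 s2 c a.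
  by case: a => [[[j r]|[i' r]]|[i' r]] /=.
(* The risk of any unbiased [L] is a deterministic weighted sum of squares times a factor
   independent of [L], so comparing risks reduces to comparing coefficients. *)
have mse (L : 'M[R]_(d, ni i + \sum_(j < n.-1) d)) : L *m Z = 1%:M ->
    (\int[P]_t (sqnorm (L *m W t - thS t i))%:E =
     (\sum_a noise_var sbar2 sc2 s2 c a *
       sqnorm (error_coef c X i (client_coef i X beta L) a))%:E *
     \int[normal_prob 0 1]_x (x ^+ 2)%:E)%E.
  rewrite /Z (mul_stackZ i X beta)// => L1.
  rewrite -(second_moment_sqnorm_combination _ _ P _ _ (noise_coord xib xi eps))//.
  by apply: eq_integral => t _; rewrite WE error_decomposition.
exists Ls; split => //; split => // L LZ.
under eq_integral do rewrite thhE.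
rewrite !mse// lee_wpmul2r//.
  by apply: integral_ge0 => x _; rewrite lee_fin sqr_ge0.
rewrite lee_fin; apply: (error_coef_optimal _ _ _ _ _ _ beta h om mu) => //.
by move: LZ; rewrite /Z (mul_stackZ i X beta).
Qed.
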